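(* Let $G$ be a finite Abelian group and let $n\ge 1$ be an integer. Then $$D(G^n) = n\, D(G) \le n\,(|G|-\operatorname{rank}(G)).$$
   Context: For a finite group $G$ with generating set $A$ and $g\in G$, $l_A(g)$ is the length of a shortest word in the elements of $A$ (no inverses allowed) representing $g$; the identity is represented by the empty word, of length $0$. The diameter is $\operatorname{diam}(G,A)=\max\{l_A(g): g\in G\}$, and $D(G)$ is the maximum of $\operatorname{diam}(G,A)$ over all generating sets $A$ of $G$. $\operatorname{rank}(G)$ is the minimum cardinality of a generating set of $G$. $G^n$ is the $n$-th direct power of $G$. *)

(* Defs.v *)
From mathcomp Require Import all_boot all_fingroup all_solvable.

Set Implicit Arguments.
Unset Strict Implicit.
Unset Printing Implicit Defensive.

Import GroupScope.

Section Diameter.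
Variable gT : finGroupType.
Implicit Types (A B : {set gT}) (g : gT) (k : nat) (w : seq gT).

Definition is_word A g w := all [in A] w && (\prod_(x <- w) x == g).

Definition has_word A g k := [exists w : k.-tuple gT, is_word A g w].

(* In a finite group the inverses are positive powers, so the monoid generated
   by A is the group <<A>>. *)
Lemma ex_word A g : g \in <<A>> -> exists k, has_word A g k.
Proof.
case/gen_prodgP=> k [c Ac ->]; exists k; apply/existsP.
exists [tuple c i | i < k]; apply/andP; split.
  by apply/allP=> _ /mapP[i _ ->]; apply: Ac.
by rewrite /= big_map enumT.
Qed.

(* The value 0 when g is not in <<A>> is a junk value. *)
Definition word_length A g : nat :=
  if @idP (g \in <<A>>) is ReflectT Ag then ex_minn (ex_word Ag) else 0.

Definition diam A : nat := \max_(g in <<A>>) word_length A g.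

Definition max_diam B : nat := \max_(A : {set gT} | <<A>> == B) diam A.

Lemma word_lengthP A g : g \in <<A>> ->
  (exists2 w, is_word A g w & size w = word_length A g)
  /\ forall w, is_word A g w -> word_length A g <= size w.
Proof.
move=> Ag; rewrite /word_length; case: {-}_ / idP => // Ag'.
case: ex_minnP => k /existsP[w Aw] min_k; split.
  by exists w; rewrite ?size_tuple.
by move=> v Av; apply: min_k; apply/existsP; exists (in_tuple v).
Qed.

End Diameter.

(* The direct power G^n, inside the product of n copies of the ambient type. *)
Definition direct_power (gT : finGroupType) (G : {group gT}) (n : nat) :
    {group {dffun forall i : 'I_n, gT}} :=
  setXn_group (fun _ : 'I_n => G).

(* Main.v *)
Require Import Defs.
From mathcomp Require Import all_boot all_fingroup all_solvable.
From mathcomp Require Import zify.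

Set Implicit Arguments.
Unset Strict Implicit.

Import GroupScope.

(* Let m_0, m_1, ... be the invariant factors of a finite abelian group G, with
   m_(i+1) | m_i and m_i = 1 for large i. They are characterised by: m_i | d iff
   the group G^d of d-th powers has rank at most i. The point is that
   D(G) = sum_i (m_i - 1).
   Lower bound: over a basis x_0, x_1, ... of type m_0, m_1, ..., the element
   prod_i x_i^(m_i - 1) has this length.
   Upper bound: add the generators one at a time. If G = <H, a>, then
   m_(i+1)(G) | m_i(H) | m_i(G), and comparing the orders of G and H this forces
   sum_i (m_i(H) - 1) + (|G : H| - 1) <= sum_i (m_i(G) - 1), while passing from
   H to G requires at most |G : H| - 1 further letters a.
   For the power, the rank criterion gives m_i(G^n) | m_(i/n)(G), and both
   sequences have product |G|^n, so they agree. *)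

(** * Subgroups of d-th powers and their ranks *)

(** Taking the generated subgroup gives a group for every [A]. When [A] is an abelian group, the set
    of powers is already closed. *)
Definition power_subgroup (gT : finGroupType) d (A : {set gT}) : {group gT} :=
  <<[set x ^+ d | x in A]>>%G.

Lemma mem_power_subgroup (gT : finGroupType) d (A : {set gT}) x :
  x \in A -> x ^+ d \in power_subgroup d A.
Proof. by move=> Ax; rewrite mem_gen //; apply: imset_f. Qed.

Lemma power_subgroupS (gT : finGroupType) d (A B : {set gT}) :
  A \subset B -> power_subgroup d A \subset power_subgroup d B.
Proof. by move=> sAB; rewrite genS // imsetS. Qed.

Lemma power_subgroup_sub (gT : finGroupType) d (G : {group gT}) :
  power_subgroup d G \subset G.
Proof. by rewrite gen_subG; apply/subsetP=> _ /imsetP[x Gx ->]; apply: groupX. Qed.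

Lemma power_subgroup_abelian {gT : finGroupType} d (G : {group gT}) :
  abelian G -> abelian (power_subgroup d G).
Proof. exact/abelianS/power_subgroup_sub. Qed.

Lemma power_subgroup_mulg (gT : finGroupType) d (K H G : {group gT}) :
  abelian G -> K * H = G ->
  power_subgroup d K * power_subgroup d H = power_subgroup d G.
Proof.
move=> abG defG.
have [sKG sHG] : K \subset G /\ H \subset G.
  by rewrite -defG mulG_subl mulG_subr.
have cPP : power_subgroup d H \subset 'C(power_subgroup d K).
  by apply: (sub_abelian_cent2 abG);
    apply: subset_trans (power_subgroup_sub _ _) _.
apply/eqP; rewrite eqEsubset mul_subG ?power_subgroupS //=.
rewrite -cent_joinEr // gen_subG; apply/subsetP=> _ /imsetP[x + ->].
rewrite -defG => /imset2P[y z Ky Hz ->].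
rewrite expgMn; last exact: (centsP abG _ (subsetP sKG _ Ky) _ (subsetP sHG _ Hz)).
by rewrite groupM // mem_gen // inE (mem_power_subgroup d Ky, mem_power_subgroup d Hz) ?orbT.
Qed.

Lemma power_subgroup_cycle (gT : finGroupType) d (x : gT) :
  power_subgroup d <[x]> = <[x ^+ d]>%G.
Proof.
apply/group_inj/eqP; rewrite /= eqEsubset cycle_subG mem_power_subgroup ?cycle_id ?andbT //.
rewrite gen_subG; apply/subsetP=> _ /imsetP[_ /cycleP[k ->] ->].
by rewrite expgAC mem_cycle.
Qed.

Lemma p_rank_bigdprod (gT : finGroupType) p (I : Type) (r : seq I)
    (E : I -> {group gT}) (G : {group gT}) :
  \big[dprod/1]_(i <- r) E i = G -> 'r_p(G) = (\sum_(i <- r) 'r_p(E i))%N.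
Proof.
elim: r G => [|i r IHr] G; rewrite ?big_nil ?big_cons.
  by move=> <-; rewrite p_rank1.
move=> defG; have [[_ H _ defH] _ _ _] := dprodP defG.
by rewrite -(IHr _ defH); move: defG; rewrite defH => /p_rank_dprod->.
Qed.

Lemma power_subgroup_bigdprod (gT : finGroupType) d (I : Type) (r : seq I)
    (E : I -> {group gT}) (G : {group gT}) :
  abelian G -> \big[dprod/1]_(i <- r) E i = G ->
  \big[dprod/1]_(i <- r) power_subgroup d (E i) = power_subgroup d G.
Proof.
elim: r G => [|i r IHr] G abG; rewrite ?big_nil ?big_cons.
  by move=> G1; apply/esym/trivgP; rewrite G1 power_subgroup_sub.
move=> defG; have [[_ H _ defH] mulEH _ tiEH] := dprodP defG.
rewrite defH in mulEH tiEH.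
have [sEG sHG] : E i \subset G /\ H \subset G.
  by rewrite -mulEH mulG_subl mulG_subr.
rewrite (IHr H (abelianS sHG abG) defH) dprodE ?(power_subgroup_mulg d abG mulEH) //.
  by apply: (sub_abelian_cent2 abG);
    apply: subset_trans (power_subgroup_sub _ _) _.
by apply/trivgP; rewrite -tiEH setISS ?power_subgroup_sub.
Qed.

Lemma p_rank_cycle (gT : finGroupType) p (x : gT) :
  prime p -> 'r_p(<[x]>) = (p %| #[x]).
Proof.
move=> p_pr; have p_piE : (0 < 'r_p(<[x]>)) = (p %| #[x]).
  by rewrite p_rank_gt0 mem_primes p_pr cardG_gt0.
have : 'r_p(<[x]>) <= 1.
  by rewrite (leq_trans (p_rank_le_rank _ _)) // rank_cycle leq_b1.
by rewrite -p_piE; case: 'r_p(_) => [|[]].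
Qed.

(** In a basis, a cyclic factor of order m contributes a cyclic group of order m / gcd(m, d), whose
    p-rank is 1 or 0 according to whether p divides that order; p-ranks add over direct products. *)
Lemma p_rank_power_subgroup (gT : finGroupType) p d (G : {group gT}) :
  prime p -> abelian G ->
  'r_p(power_subgroup d G)
    = count (fun m => p %| m %/ gcdn m d) (abelian_type G).
Proof.
move=> p_pr abG; have [b defG <-] := abelian_structure abG.
have defGd := power_subgroup_bigdprod (E := fun x => <[x]>%G) d abG defG.
rewrite (p_rank_bigdprod p defGd).
rewrite count_map -sum1_count [RHS]big_mkcond; apply: eq_bigr => x _.
by rewrite power_subgroup_cycle p_rank_cycle //= orderXgcd; case: (_ %| _).
Qed.

(** * Invariant factors and the rank criterion *)

(* The junk value 1 past the end of the type is the right one: it makes all the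
   statements below valid for every index. *)
Definition invfactor (gT : finGroupType) (G : {group gT}) i :=
  nth 1%N (abelian_type G) i.

Lemma invfactor_gt0 (gT : finGroupType) (G : {group gT}) i :
  0 < invfactor G i.
Proof.
rewrite /invfactor; have [szi|?] := ltnP i (size (abelian_type G)).
  exact/ltnW/(allP (abelian_type_gt1 G))/mem_nth.
by rewrite nth_default.
Qed.

Lemma dvdn_invfactor (gT : finGroupType) (G : {group gT}) i j :
  i <= j -> invfactor G j %| invfactor G i.
Proof.
rewrite /invfactor => le_ij.
have [szj|?] := ltnP j (size (abelian_type G)); last by rewrite nth_default.
have Rtr: transitive [rel m n | n %| m].
  by move=> m n p /= mn pm; apply: dvdn_trans pm mn.
apply: (sorted_leq_nth Rtr _ 1%N (abelian_type_dvdn_sorted G)) => //.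
  by move=> ?; apply: dvdnn.
by rewrite inE (leq_ltn_trans le_ij).
Qed.

Lemma dvdn_divgcd m d k : 0 < m -> (m %/ gcdn m d %| k) = (m %| (d * k)%N).
Proof.
move=> m_gt0; have g_gt0 : 0 < gcdn m d by rewrite gcdn_gt0 m_gt0.
rewrite -[X in X %| (d * k)%N](divnK (dvdn_gcdl m d)).
rewrite -[X in (X * k)%N](divnK (dvdn_gcdr m d)) mulnAC dvdn_pmul2r //.
rewrite Gauss_dvdr // /coprime -(eqn_pmul2r g_gt0) muln_gcdl.
by rewrite !divnK ?dvdn_gcdl ?dvdn_gcdr // mul1n.
Qed.

(** The rank is a p-rank, hence a count over the type. If m_i divides d, so do all later entries,
    and only the first i can count. Otherwise a prime divisor of m_i / gcd(m_i, d) makes the first i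
    + 1 entries count. *)
Lemma dvdn_invfactorE (gT : finGroupType) (G : {group gT}) i d :
  abelian G -> (invfactor G i %| d) = ('r(power_subgroup d G) <= i).
Proof.
move=> abG; apply/idP/idP=> [mi_d | ].
  have [p p_pr ->] := rank_witness (power_subgroup d G).
  rewrite p_rank_power_subgroup // -(cat_take_drop i (abelian_type G)) count_cat.
  rewrite -[i in X in _ <= X]addn0 leq_add //.
    by rewrite (leq_trans (count_size _ _)) // size_take geq_minl.
  rewrite leqn0 -leqn0 leqNgt -has_count -all_predC; apply/(all_nthP 1%N) => j.
  rewrite size_drop => _; rewrite nth_drop /=.
  have dvd_d := dvdn_trans (dvdn_invfactor G (leq_addr j i)) mi_d.
  rewrite -/(invfactor G (i + j)) (gcdn_idPl dvd_d) divnn invfactor_gt0.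
  by rewrite dvdn1; case: p p_pr => [|[]].
apply: contraLR => mi_d; rewrite -ltnNge.
set m := invfactor G i in mi_d; have m_gt0 : 0 < m := invfactor_gt0 _ _.
pose p := pdiv (m %/ gcdn m d).
have szi : i < size (abelian_type G).
  by rewrite ltnNge; apply: contra mi_d => ?; rewrite /m /invfactor nth_default.
have p_pr : prime p.
  rewrite pdiv_prime // ltn_neqAle eq_sym divn_gt0 ?gcdn_gt0 ?m_gt0 //.
  rewrite dvdn_leq ?dvdn_gcdl // andbT; apply: contra mi_d => /eqP m1.
  by rewrite -[d]muln1 -dvdn_divgcd // m1.
apply: leq_trans (p_rank_le_rank p _); rewrite p_rank_power_subgroup //.
rewrite -(cat_take_drop i.+1 (abelian_type G)) count_cat.
suff /eqP-> : count (fun n => p %| n %/ gcdn n d) (take i.+1 (abelian_type G)) == i.+1.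
  exact: leq_addr.
rewrite -[X in _ == X](size_takel szi) -all_count; apply/(all_nthP 1%N) => j.
rewrite size_takel // => lt_ji; rewrite nth_take //= -/(invfactor G j).
(* By [dvdn_divgcd], m_i / gcd(m_i, d) divides m_j / gcd(m_j, d) as soon as m_i divides d * (m_j /
   gcd(m_j, d)), which is a multiple of m_j. *)
apply: (dvdn_trans (pdiv_dvd _)); rewrite dvdn_divgcd //.
apply: (dvdn_trans (dvdn_invfactor G (lt_ji : j <= i))).
by rewrite -dvdn_divgcd ?invfactor_gt0.
Qed.

(** Padding by 1 leaves [N] free, so that groups of different ranks can be compared over one index
    range. *)
Lemma prod_invfactor (gT : finGroupType) (G : {group gT}) N :
  abelian G -> 'r(G) <= N -> (\prod_(0 <= i < N) invfactor G i)%N = #|G|.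
Proof.
move=> abG; rewrite -size_abelian_type // => szN.
rewrite (big_cat_nat_idem _ (leq0n _) szN) ?muln1 //=.
rewrite [X in (_ * X)%N]big1_seq ?muln1 => [|i].
  rewrite -(big_nth _ xpredT id); have [b /bigdprod_card<- <-] := abelian_structure abG.
  by rewrite big_map.
by rewrite /= mem_index_iota => /andP[szi _]; apply: nth_default.
Qed.

(** * Growth of the invariant sum when a generator is added *)

Definition invariant_sum (gT : finGroupType) (G : {group gT}) : nat :=
  \sum_(m <- abelian_type G) m.-1.

Lemma invariant_sumE (gT : finGroupType) (G : {group gT}) N :
  abelian G -> 'r(G) <= N ->
  invariant_sum G = \sum_(0 <= i < N) (invfactor G i).-1.
Proof.
move=> abG; rewrite -size_abelian_type // => szN.
rewrite (big_cat_nat_idem _ (leq0n _) szN) ?addn0 //=.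
rewrite [X in (_ + X)%N]big1_seq ?addn0 => [|i].
  by rewrite /invariant_sum (big_nth 1%N).
by rewrite /= mem_index_iota /invfactor => /andP[szi _]; rewrite nth_default.
Qed.

(* With q_i = M_i / P_i and Q_i = q_i q_(i+1) ..., interlacing gives
   Q_(i+1) <= M_(i+1) <= P_i, so (q_i - 1) Q_(i+1) <= (q_i - 1) P_i = M_i - P_i,
   and the left-hand sides telescope. *)
Lemma sum_interlaced (M P : nat -> nat) N :
  (forall i, 0 < M i) -> (forall i, P i %| M i) -> (forall i, M i.+1 <= P i) ->
  let q := (\prod_(0 <= i < N) (M i %/ P i))%N in
  0 < q <= M 0 /\
  \sum_(0 <= i < N) (P i).-1 + q.-1 <= \sum_(0 <= i < N) (M i).-1.
Proof.
elim: N M P => [|N IHN] M P M_gt0 PM MP /=; first by rewrite !big_geq // M_gt0.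
have [] := IHN (fun i => M i.+1) (fun i => P i.+1) _ _ _ => //=.
rewrite !big_nat_recl // => /andP[q_gt0 q_le].
have /dvdnP[k Mk] := PM 0; have := MP 0; have := M_gt0 0.
rewrite Mk muln_gt0 => /andP[k_gt0 P_gt0]; rewrite mulnK // => M1P.
set q := (\prod_(0 <= i < N) _)%N in q_gt0 q_le *.
set sP := \sum_(0 <= i < N) _; set sM := \sum_(0 <= i < N) _ => IH.
have qP : q <= P 0 := leq_trans q_le M1P.
case: k k_gt0 {Mk} => // k _; case: q q_gt0 {q_le} IH qP => // q _.
case: (P 0) P_gt0 => // p _; rewrite !mulSn; nia.
Qed.

(** The rank of an abelian group is its least number of generators, and [x] can be added to a
    minimal generating set of [K]. *)
Lemma rank_mulg_cycle (gT : finGroupType) (K G : {group gT}) x :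
  abelian G -> K * <[x]> = G -> 'r(G) <= 'r(K).+1.
Proof.
move=> abG defG; have sKG : K \subset G by rewrite -defG mulG_subl.
rewrite -!grank_abelian ?(abelianS sKG) //.
have [B defK <-] := grank_witness K.
suff <- : <<x |: B>> = G.
  by rewrite (leq_trans (grank_min _)) // cardsU1; case: (x \notin B).
rewrite -joingE joingC -joing_idl -joing_idr.
by rewrite defK -[RHS]defG cent_joinEr // (sub_abelian_cent2 abG) // -defG mulG_subr.
Qed.

Lemma invariant_sum_extend (gT : finGroupType) (H G : {group gT}) x :
  abelian G -> H * <[x]> = G ->
  invariant_sum H + #|G : H|.-1 <= invariant_sum G.
Proof.
move=> abG defG; have sHG : H \subset G by rewrite -defG mulG_subl.
have abH := abelianS sHG abG; set N := 'r(G).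
have rHN : 'r(H) <= N := rankS sHG.
have PM i : invfactor H i %| invfactor G i.
  rewrite dvdn_invfactorE // (leq_trans (rankS (power_subgroupS _ sHG))) //.
  by rewrite -dvdn_invfactorE.
(* The d-th powers of [G] are those of [H] times the cycle of [x ^+ d], so the rank grows by at most
   1; take d = m_i(H). *)
have MP i : invfactor G i.+1 <= invfactor H i.
  rewrite dvdn_leq ?invfactor_gt0 // dvdn_invfactorE //.
  have := power_subgroup_mulg (invfactor H i) abG defG.
  rewrite power_subgroup_cycle => /(rank_mulg_cycle (power_subgroup_abelian _ abG)).
  by move/leq_trans; apply; rewrite ltnS -dvdn_invfactorE.
have [_] := sum_interlaced N (invfactor_gt0 G) PM MP.
rewrite -!invariant_sumE //.
(* Both products of invariant factors are group orders, so the quotients multiply to the index. *)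
suff -> : (\prod_(0 <= i < N) (invfactor G i %/ invfactor H i))%N = #|G : H| by [].
apply/eqP; rewrite -(eqn_pmul2l (cardG_gt0 H)) Lagrange //.
rewrite -(prod_invfactor abH rHN) -(prod_invfactor abG (leqnn _)) -big_split /=.
by apply/eqP/eq_bigr=> i _; rewrite mulnC divnK.
Qed.

(** * Upper bound for word lengths *)

Lemma exists_short_word (gT : finGroupType) (s : seq gT) (G : {group gT}) g :
  abelian G -> <<[set x in s]>> = G -> g \in G ->
  exists2 w, all [in s] w && (\prod_(x <- w) x == g) & size w <= invariant_sum G.
Proof.
elim: s G g => [|a s IHs] G g abG.
  move=> defG; rewrite -defG (_ : [set x in Nil gT] = set0) ?gen0.
    by move/set1P->; exists [::]; rewrite //= big_nil.
  by apply/setP=> x; rewrite !inE.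
move=> genG Gg; set H := <<[set x in s]>>%G.
have sHG : H \subset G.
  by rewrite -genG genS //; apply/subsetP=> x; rewrite !inE orbC => ->.
have Ga : a \in G by rewrite -genG mem_gen // !inE eqxx.
have defG : H * <[a]> = G.
  rewrite -cent_joinEr ?(sub_abelian_cent2 abG) ?cycle_subG //.
  by rewrite joing_idl joing_idr joingC -[RHS]genG set_cons.
set n := #|G : H|; have n_gt0 : 0 < n := indexg_gt0 _ _.
(* The quotient of [G] by [H] has order [n]. *)
have Han : a ^+ n \in H.
  have nHG : G \subset 'N(H) := sub_abelian_norm abG sHG.
  have nHa := subsetP nHG a Ga.
  rewrite coset_idr ?groupX // morphX // /n -card_quotient // expg_cardG //.
  exact: mem_quotient.
have: g \in H * <[a]> by rewrite defG.
case/imset2P=> h _ Hh /cycleP[k ->] def_g.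
(* Divide [k] by [n]: the multiple of [n] is absorbed into [H], and the remainder, at most [n.-1],
   counts the letters [a] to append. *)
have [|||w /andP[sw /eqP prod_w] size_w] := IHs H (h * (a ^+ n) ^+ (k %/ n)).
- exact: abelianS abG.
- by [].
- by rewrite groupM // groupX.
exists (w ++ nseq (k %% n) a).
  rewrite all_cat big_cat prod_w /= big_nseq -Monoid.iteropE /=.
  apply/andP; split; first (apply/andP; split).
  - by apply: sub_all sw => x /= sx; rewrite inE sx orbT.
  - by apply/allP=> x /nseqP[-> _]; rewrite mem_head.
  by rewrite def_g -mulgA -expgM -expgD mulnC -divn_eq.
rewrite size_cat size_nseq (leq_trans _ (invariant_sum_extend abG defG)) //.
by rewrite leq_add // -ltnS prednK // ltn_mod.
Qed.

(** * Lower bound from a basis *)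

(** Gathering the letters [x] in front isolates one basis element, so that exponents can be compared
    factor by factor. *)
Lemma split_word (gT : finGroupType) x (s w : seq gT) :
  {in s, forall y, commute x y} -> all [in x :: s] w ->
  exists k v, [/\ all [in s] v, size w = k + size v
                & \prod_(y <- w) y = x ^+ k * \prod_(y <- v) y].
Proof.
move=> cxs; elim: w => [|y w IHw] /=; first by exists 0, [::]; rewrite big_nil mulg1.
rewrite inE => /andP[xsy /IHw[k [v [sv -> def_w]]]].
have [-> | neq_yx] := eqVneq y x.
  by exists k.+1, v; rewrite sv big_cons def_w expgS mulgA.
rewrite (negPf neq_yx) /= in xsy.
exists k, (y :: v); rewrite /= sv xsy !big_cons def_w addnS !mulgA.
by rewrite -(commuteX k (commute_sym (cxs y xsy))).
Qed.

Lemma gen_bigdprod_cycle (gT : finGroupType) (b : seq gT) (G : {group gT}) :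
  \big[dprod/1]_(x <- b) <[x]> = G -> <<[set x in b]>> = G.
Proof.
elim: b G => [|x b IHb] G; rewrite ?big_nil ?big_cons.
  move=> <-; rewrite (_ : [set x in Nil gT] = set0) ?gen0 //.
move=> defG; have [[_ H _ defH] _ _ _] := dprodP defG.
by rewrite set_cons -joingE -joing_idl -joing_idr (IHb H defH) -defH (dprodWY defG).
Qed.

Lemma mem_bigdprod_cycle (gT : finGroupType) (b : seq gT) (G : {group gT}) :
  \big[dprod/1]_(x <- b) <[x]> = G -> {subset b <= G}.
Proof. by move/gen_bigdprod_cycle=> <- x bx; rewrite mem_gen // inE. Qed.

Lemma basis_word_size (gT : finGroupType) (b w : seq gT) (G : {group gT}) :
  abelian G -> \big[dprod/1]_(x <- b) <[x]> = G ->
  all (fun x => 1 < #[x]) b -> all [in b] w ->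
  \prod_(x <- w) x = \prod_(x <- b) x ^+ #[x].-1 ->
  (\sum_(x <- b) #[x].-1 <= size w)%N.
Proof.
elim: b w G => [|x b IHb] w G abG; first by rewrite !big_nil.
move=> defG /= /andP[ox ob] bw; have Gb := mem_bigdprod_cycle defG.
have cxb : {in b, forall y, commute x y}.
  by move=> y by_; apply: (centsP abG); rewrite Gb // inE ?eqxx // by_ orbT.
have [k [v [bv -> ->]]] := split_word cxb bw.
rewrite !big_cons in defG *; have [[_ H _ defH] mulG _ tiH] := dprodP defG.
rewrite defH in mulG tiH; have Hb := mem_bigdprod_cycle defH.
have Hv : \prod_(y <- v) y \in H.
  by rewrite big_seq group_prod // => y /(allP bv)/Hb.
have Hb' : \prod_(y <- b) y ^+ #[y].-1 \in H.
  by rewrite big_seq group_prod // => y /Hb; apply: groupX.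
move=> eq_prod.
(* The quotient of the two powers lies in [<[x]>] and, by [eq_prod], in [H]; these meet
   trivially. *)
have xk : x ^+ k = x ^+ #[x].-1.
  apply/eqP; rewrite eq_mulVg1 -in_set1 -[[set 1]]tiH inE.
  rewrite groupM ?groupV ?mem_cycle //=.
  have -> : (x ^+ k)^-1 * x ^+ #[x].-1
      = \prod_(y <- v) y * (\prod_(y <- b) y ^+ #[y].-1)^-1.
    by apply: (canRL (mulgK _)); rewrite -mulgA -eq_prod mulKg.
  by rewrite groupM ?groupV.
rewrite leq_add //; last first.
  apply: (IHb v H) => //; first by rewrite (abelianS _ abG) // -mulG mulG_subr.
  by apply: (mulgI (x ^+ k)); rewrite eq_prod xk.
(* The remainder of [k] modulo [#[x]] is [#[x].-1], and a remainder never exceeds the number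
   itself. *)
move/eqP: xk; rewrite eq_expg_mod_order [X in _ == X]modn_small ?prednK ?order_gt0 //.
by move/eqP<-; apply: leq_mod.
Qed.

Theorem max_diam_abelian (gT : finGroupType) (G : {group gT}) :
  abelian G -> max_diam G = invariant_sum G.
Proof.
move=> abG; apply/eqP; rewrite eqn_leq; apply/andP; split.
  apply/bigmax_leqP=> A /eqP genA; apply/bigmax_leqP=> g Ag.
  have [||w] := @exists_short_word _ (enum A) G g abG; rewrite ?set_enum -?genA //.
  move=> /andP[Aw prod_w]; apply: leq_trans; apply: (word_lengthP Ag).2.
  by rewrite /is_word prod_w andbT; apply: sub_all Aw => x; rewrite mem_enum.
have [b defG def_t] := abelian_structure abG.
have genb := gen_bigdprod_cycle defG.
(* The maximum is attained at the generating set formed by a basis. *)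
apply: (bigmax_sup [set x in b]); first exact/eqP.
set g := \prod_(x <- b) x ^+ #[x].-1.
have gb : g \in <<[set x in b]>>.
  rewrite genb /g big_seq group_prod // => x /(mem_bigdprod_cycle defG).
  exact: groupX.
apply: (bigmax_sup g) => //.
have [[w /andP[bw /eqP prod_w] <-] _] := word_lengthP gb.
rewrite /invariant_sum -def_t big_map; apply: basis_word_size defG _ _ prod_w => //.
  by have := abelian_type_gt1 G; rewrite -def_t all_map.
by apply: sub_all bw => x; rewrite inE.
Qed.

(** * Arithmetic of sums and products *)

Lemma sum_prod_size (t : seq nat) :
  all (fun m => 1 < m) t -> (\sum_(m <- t) m.-1 + size t <= \prod_(m <- t) m)%N.
Proof.
(* The inductive step rests on m + p <= m * p, which fails for the empty product p = 1; hence the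
   induction starts at one entry. *)
move=> t1; suff : (0 < size t -> \sum_(m <- t) m.-1 + size t <= \prod_(m <- t) m)%N.
  by case: t {t1} => [_|m t]; [rewrite !big_nil | apply].
elim: t t1 => //= m [|n t] IHt /andP[m1 t1] _; first by rewrite !big_cons !big_nil /=; lia.
rewrite big_cons [X in _ <= X]big_cons; have := IHt t1 isT.
have : 1 < (\prod_(j <- n :: t) j)%N.
  have /andP[n1 t1'] : all (fun m => 1 < m) (n :: t) := t1.
  rewrite big_cons (leq_trans n1) // leq_pmulr // big_seq prodn_cond_gt0 //.
  by move=> j /(allP t1')/ltnW.
by move: (\prod_(j <- _) _)%N (\sum_(j <- _) _)%N (size _) => p s z /=; nia.
Qed.

Lemma eq_of_leq_prod N (a b : nat -> nat) :
  (forall i, 0 < a i <= b i) ->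
  (\prod_(0 <= i < N) a i = \prod_(0 <= i < N) b i)%N ->
  forall i, i < N -> a i = b i.
Proof.
move=> ab; elim: N => // N IHN; rewrite !big_nat_recr //=.
have : (0 < \prod_(0 <= i < N) a i <= \prod_(0 <= i < N) b i)%N.
  rewrite prodn_gt0 => [|i]; last by case/andP: (ab i).
  by rewrite leq_prod // => i _; case/andP: (ab i).
move=> /andP[A_gt0 AB] eqAB i.
have /andP[a_gt0 le_ab] := ab N.
have [eqA eqa] : (\prod_(0 <= i < N) a i = \prod_(0 <= i < N) b i)%N /\ a N = b N.
  by move: (\prod_(_ <= _ < _) _)%N (\prod_(_ <= _ < _) b _)%N A_gt0 AB eqAB => A B *; nia.
by rewrite ltnS leq_eqVlt => /predU1P[->|/IHN->].
Qed.

(** * Direct powers *)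

Lemma direct_power_abelian (gT : finGroupType) (G : {group gT}) n :
  abelian G -> abelian (direct_power G n).
Proof.
move=> abG; apply/centsP=> f /setXnP Gf g /setXnP Gg.
by apply/ffunP=> i; rewrite !ffunE (centsP abG) ?Gf ?Gg.
Qed.

(** The rank is attained at a single prime p, and p-ranks add over direct products. *)
Lemma rank_direct_power (gT : finGroupType) (G : {group gT}) n :
  'r(direct_power G n) <= n * 'r(G).
Proof.
have [p _ ->] := rank_witness (direct_power G n).
rewrite (p_rank_bigdprod p (setXn_dprod (fun _ : 'I_n => G))).
apply: leq_trans (_ : \sum_(i < n) 'r(G) <= _); last by rewrite sum_nat_const card_ord.
apply: leq_sum => i _; rewrite -(isog_p_rank (isog_setXn (i := i) G)).
exact: p_rank_le_rank.
Qed.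

Lemma power_subgroup_direct_power (gT : finGroupType) d (G : {group gT}) n :
  power_subgroup d (direct_power G n) \subset direct_power (power_subgroup d G) n.
Proof.
rewrite gen_subG; apply/subsetP=> _ /imsetP[f /setXnP Gf ->]; apply/setXnP=> i.
suff -> : (f ^+ d) i = f i ^+ d by apply: mem_power_subgroup.
by elim: d => [|d IHd]; rewrite ?ffunE // !expgS ffunE IHd.
Qed.

(** For d = m_(i/n)(G) the d-th powers of [G] have rank at most [i %/ n], so those of the direct
    power have rank at most n * (i / n) <= i. *)
Lemma invfactor_direct_power_dvd (gT : finGroupType) (G : {group gT}) n i :
  abelian G -> 0 < n ->
  invfactor (direct_power G n) i %| invfactor G (i %/ n).
Proof.
move=> abG n_gt0; rewrite dvdn_invfactorE ?direct_power_abelian //.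
apply: leq_trans (rankS (power_subgroup_direct_power _ _ _)) _.
apply: leq_trans (rank_direct_power _ _) _.
by rewrite mulnC -leq_divRL // -dvdn_invfactorE.
Qed.

Lemma invariant_sum_direct_power (gT : finGroupType) (G : {group gT}) n :
  abelian G -> 0 < n ->
  invariant_sum (direct_power G n) = (n * invariant_sum G)%N.
Proof.
move=> abG n_gt0; have abGn := direct_power_abelian n abG.
(* Each invariant factor of [G] fills a block of [n] consecutive indices. *)
have const (F : nat -> nat) j : forall i, j * n <= i < j.+1 * n -> F (i %/ n) = F j.
  move=> i /andP[le_ji lt_ij]; congr F; apply/eqP.
  by rewrite eqn_leq leq_divRL // le_ji andbT -ltnS ltn_divLR.
have rGn : 'r(direct_power G n) <= 'r(G) * n by rewrite mulnC rank_direct_power.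
rewrite (invariant_sumE abGn rGn) (invariant_sumE abG (leqnn _)).
have eq_inv : forall i, i < 'r(G) * n ->
    invfactor (direct_power G n) i = invfactor G (i %/ n).
  apply: eq_of_leq_prod => [i|].
    by rewrite invfactor_gt0 dvdn_leq ?invfactor_gt0 ?invfactor_direct_power_dvd.
  (* Both products equal the n-th power of the order of [G]. *)
  rewrite prod_invfactor // cardsXn prod_nat_const card_ord.
  rewrite -(prod_invfactor abG (leqnn _)) big_nat_mul /=.
  have expn_prod s : (\prod_(i <- s) invfactor G i ^ n = (\prod_(i <- s) invfactor G i) ^ n)%N.
    by elim/big_rec2: _ => [|i x _ _ ->]; rewrite ?exp1n ?expnMn.
  rewrite -expn_prod; apply: eq_bigr => j _.
  rewrite (eq_big_nat _ _ (const (invfactor G) j)) prod_nat_const_nat.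
  by rewrite mulSn addnK.
rewrite (eq_big_nat _ _ (F2 := fun i => (invfactor G (i %/ n)).-1)); last first.
  by move=> i /andP[_ /eq_inv->].
rewrite big_nat_mul big_distrr; apply: eq_bigr => j _.
rewrite (eq_big_nat _ _ (const (fun i => (invfactor G i).-1) j)) sum_nat_const_nat.
by rewrite mulSn addnK.
Qed.

Theorem corollary3p2 (gT : finGroupType) (G : {group gT}) (n : nat)
    (abG : abelian G) (n_gt0 : (1 <= n)%N) :
  max_diam (direct_power G n) = (n * max_diam G)%N /\
  (n * max_diam G <= n * (#|G| - 'm(G)))%N.
Proof.
rewrite !max_diam_abelian ?direct_power_abelian //.
split; first exact: invariant_sum_direct_power.
rewrite leq_mul2l; apply/orP; right.
have [b defG def_t] := abelian_structure abG.
(* The type has ['m(G)] entries, with product [#|G|]. *)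
have := sum_prod_size (abelian_type_gt1 G).
rewrite size_abelian_type // -grank_abelian //.
have -> : (\prod_(m <- abelian_type G) m)%N = #|G|.
  by rewrite -def_t big_map -(bigdprod_card defG).
by move/(leq_sub2r 'm(G)); rewrite addnK.
Qed.
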